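(* In the setting of the context, let $(\boldsymbol\sigma,u)\in H_{g,-}(\mathrm{div};\Omega)\times L^2(\Omega)$ be the minimizer of $\mathcal J(\cdot,\cdot;f,g)$ over $H_{g,-}(\mathrm{div};\Omega)\times L^2(\Omega)$, suppose that $(\boldsymbol\beta\cdot\mathbf n)g$ on $\Gamma_-$ is exactly represented by the normal trace of $RT_k$ on $\Gamma_-$ (i.e. $((\boldsymbol\beta\cdot\mathbf n)g)|_F\in P_k(F)$ for all $F\in\mathcal E_-$), and let $(\boldsymbol\sigma_h,u_h)\in RT_{k,g,-}\times P_k$ be the minimizer of $\mathcal J(\cdot,\cdot;f,g)$ over $RT_{k,g,-}\times P_k$. Then $$|\!|\!|(\boldsymbol\sigma-\boldsymbol\sigma_h,u-u_h)|\!|\!|\le\inf_{(\boldsymbol\tau_h,v_h)\in RT_{k,g,-}\times P_k}|\!|\!|(\boldsymbol\sigma-\boldsymbol\tau_h,u-v_h)|\!|\!|.$$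
   Context: $\Omega\subset\mathbb R^d$ is a bounded polyhedral domain with Lipschitz boundary and unit outward normal $\mathbf n$. $\boldsymbol\beta\in[C^1(\overline\Omega)]^d$ and $\gamma\in L^\infty(\Omega)$ with $\gamma+\frac12\nabla\cdot\boldsymbol\beta\ge 0$. Set $\Gamma_-=\{x\in\partial\Omega:\boldsymbol\beta\cdot\mathbf n<0\}$ (inflow) and $\Gamma_+=\{x\in\partial\Omega:\boldsymbol\beta\cdot\mathbf n>0\}$ (outflow). One of the following holds: (i) $0<|\boldsymbol\beta|<C$ for a constant $C$; there is a transformation to a coordinate system in which the streamlines of $\boldsymbol\beta$ starting on $\Gamma_-$ are lined up with one coordinate direction $r$ and whose Jacobian is bounded; and every streamline connects $\Gamma_-$ and $\Gamma_+$ with finite length; (ii) there is $\gamma_0>0$ with $\gamma+\frac12\nabla\cdot\boldsymbol\beta\ge\gamma_0$ in $\Omega$, and the inflow and outflow boundaries are well separated (at positive distance). $f\in L^2(\Omega)$ and $g$ is measurable on $\Gamma_-$ with $\int_{\Gamma_-}|\boldsymbol\beta\cdot\mathbf n|g^2<\infty$. $\mathcal J(\boldsymbol\tau,v;f,g)=\|\boldsymbol\tau-\boldsymbol\beta v\|_0^2+\|\nabla\cdot\boldsymbol\tau+\gamma v-f\|_0^2$, $|\!|\!|(\boldsymbol\tau,v)|\!|\!|=(\|\boldsymbol\tau-\boldsymbol\beta v\|_0^2+\|\nabla\cdot\boldsymbol\tau+\gamma v\|_0^2)^{1/2}$, with $\|\cdot\|_0$ the $L^2(\Omega)$ norm, and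 $H_{g,-}(\mathrm{div};\Omega)=\{\boldsymbol\tau\in H(\mathrm{div};\Omega):\boldsymbol\tau\cdot\mathbf n=(\boldsymbol\beta\cdot\mathbf n)g\text{ on }\Gamma_-\}$. $\mathcal T$ is a regular (conforming, shape-regular) simplicial triangulation of $\Omega$; $\mathcal E_-$ is the set of mesh edges/faces on $\Gamma_-$, which are assumed to cover $\Gamma_-$ up to a null set. For integer $k\ge0$, $P_k(K)$ denotes polynomials of degree $\le k$ on $K$; $RT_k=\{\boldsymbol\tau\in H(\mathrm{div};\Omega):\boldsymbol\tau|_K\in P_k(K)^d+\mathbf xP_k(K)\ \forall K\in\mathcal T\}$; $P_k=\{v\in L^2(\Omega):v|_K\in P_k(K)\ \forall K\in\mathcal T\}$; $RT_{k,g,-}=\{\boldsymbol\tau\in RT_k:\boldsymbol\tau\cdot\mathbf n=(\boldsymbol\beta\cdot\mathbf n)g\text{ on }\Gamma_-\}$. *)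

(* Defs.v *)
From HB Require Import structures.
From mathcomp Require Import all_boot all_order all_algebra.
From mathcomp Require Import all_classical all_reals all_analysis.
From mathcomp Require Import lra.
From mathcomp Require mpoly.
Import (canonicals, coercions) mpoly.

Set Implicit Arguments.
Unset Strict Implicit.
Unset Printing Implicit Defensive.

Import Order.TTheory GRing.Theory Num.Theory numFieldNormedType.Exports.

Local Open Scope classical_set_scope.
Local Open Scope ring_scope.

Definition borel_rV_display : measure_display.
Proof. exact: default_measure_display. Qed.

HB.instance Definition _ (R : realType) n := @isMeasurable.Build
  borel_rV_display 'rV[R]_n <<s @open 'rV[R]_n >>
  (@sigma_algebra0 _ setT _) (@sigma_algebraC _ _) (@sigma_algebra_bigcup _ _ _).

Section lebesgue_rV.
Context {R : realType}.

Lemma open_measurable_rV n (A : set 'rV[R]_n) : open A -> measurable A.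
Proof. exact: sub_sigma_algebra. Qed.

Lemma closed_measurable_rV n (A : set 'rV[R]_n) : closed A -> measurable A.
Proof.
move=> cA; rewrite -(setCK A); apply: measurableC; apply: open_measurable_rV.
exact: closed_openC.
Qed.

Lemma continuous_measurable_rV m n (F : 'rV[R]_m -> 'rV[R]_n) :
  continuous F -> measurable_fun setT F.
Proof.
move=> /continuousP cF; apply: (measurability (@open 'rV[R]_n)) => //.
by move=> _ [A oA <-]; rewrite setTI; apply: open_measurable_rV; apply: cF.
Qed.

Definition ratball n (i : 'rV[rat]_n * rat) : set 'rV[R]_n :=
  [set x | forall j, `|x 0 j - ratr (i.1 0 j)| < ratr i.2].

Lemma rV_bigcup_ratball n (A : set 'rV[R]_n) : open A ->
  A = \bigcup_i (if `[< ratball i `<=` A >] then ratball i else set0).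
Proof.
move=> oA; apply/seteqP; split => [x Ax|x [i _]]; last first.
  by case: asboolP => [iA /iA|].
have /nbhs_ballP[e /= e0 eA] : nbhs x A by exact: open_nbhs_nbhs.
have e20 : 0 < e / 2 by rewrite divr_gt0.
have [r] := rat_in_itvoo e20; rewrite in_itv/= => /andP[r0 re].
have xq j : exists q : rat, ratr q \in `]x 0 j - ratr r, x 0 j + ratr r[.
  by apply: rat_in_itvoo; lra.
have [q qP] := choice xq.
exists (\row_j q j, r) => //.
have xi : ratball (\row_j q j, r) x.
  move=> j /=; rewrite mxE.
  have := qP j; rewrite in_itv/= => /andP[q1 q2].
  by rewrite ltr_norml; apply/andP; split; lra.
rewrite ifT//; apply/asboolP => y yi; apply: eA; split => // i j.
rewrite ord1 /ball/=; have := xi j; have := yi j; rewrite /= !mxE.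
rewrite !ltr_norml => /andP[? ?] /andP[? ?].
by apply/andP; split; lra.
Qed.

Definition cons_rV n (p : measurableTypeR R * 'rV[R]_n) : 'rV[R]_n.+1 :=
  \row_j oapp (p.2 0) p.1 (unlift 0 j).

Lemma measurable_coord_rV n j c (r : R) :
  measurable [set x : 'rV[R]_n | `|x 0 j - c| < r].
Proof.
apply: open_measurable_rV.
rewrite (_ : mkset _ = (fun x : 'rV[R]_n => x 0 j) @^-1` ball c r); last first.
  by apply/seteqP; split => x /=; rewrite /ball/= distrC.
apply: open_comp; last exact: ball_open.
by move=> x _; exact: coord_continuous.
Qed.

Lemma measurable_cons_rV n : measurable_fun setT (@cons_rV n).
Proof.
apply: (measurability (@open 'rV[R]_n.+1)) => // _ [A oA <-].
rewrite setTI (rV_bigcup_ratball oA) preimage_bigcup.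
apply: countable_bigcupT_measurable => [|i]; first exact: countableP.
case: ifP => _; last by rewrite preimage_set0.
rewrite [X in measurable X](_ : _ =
   ball (ratr (i.1 0 0) : R) (ratr i.2) `*`
   \bigcap_(j in [set: 'I_n]) [set x : 'rV[R]_n |
     `|x 0 j - ratr (i.1 0 (lift 0 j))| < ratr i.2]).
  apply: measurableX; first exact: measurable_realfun.measurable_ball.
  by apply: fin_bigcap_measurable => // j _; exact: measurable_coord_rV.
apply/seteqP; split => [[a v] /= h|[a v] [/= ha hv] j].
  split => [|j _ /=].
    by have := h 0; rewrite mxE unlift_none /= distrC.
  by have := h (lift 0 j); rewrite mxE liftK.
rewrite /ball/= distrC in ha.
by rewrite mxE; case: unliftP => [k ->|->] //=; exact: hv.
Qed.

Definition behead_rV n (x : 'rV[R]_n.+1) : 'rV[R]_n := \row_j x 0 (lift 0 j).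

Lemma cons_rVK n (x : 'rV[R]_n.+1) : cons_rV (x 0 0, behead_rV x) = x.
Proof.
by apply/rowP => j; rewrite mxE; case: unliftP => [k|] -> //=; rewrite mxE.
Qed.

Lemma behead_consK n (p : measurableTypeR R * 'rV[R]_n) :
  behead_rV (cons_rV p) = p.2.
Proof. by apply/rowP => j; rewrite !mxE liftK. Qed.

Lemma head_consK n (p : measurableTypeR R * 'rV[R]_n) : cons_rV p 0 0 = p.1.
Proof. by rewrite mxE unlift_none. Qed.

Lemma measurable_behead_rV n : measurable_fun setT (@behead_rV n).
Proof.
apply: continuous_measurable_rV => x A /nbhs_ballP[e /= e0 eA].
apply/nbhs_ballP; exists e => //= y [_ xy]; apply: eA; split => // i j.
by rewrite !mxE; exact: xy.
Qed.

Lemma measurable_head_rV n :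
  measurable_fun setT (fun x : 'rV[R]_n.+1 => x 0 0 : measurableTypeR R).
Proof.
apply: (measurability _ (measurable_realfun.RGenOpens.measurableE R)).
move=> _ [_ [a [b ->]] <-]; rewrite setTI; apply: open_measurable_rV.
apply: open_comp; last exact: interval_open.
by move=> x _; exact: coord_continuous.
Qed.

Section cons.
Context n (m : {sigma_finite_measure set 'rV[R]_n -> \bar R}).

Definition lebesgue_cons : set 'rV[R]_n.+1 -> \bar R :=
  pushforward (@lebesgue_measure R \x m)%E (@cons_rV n).

Let lebesgue_cons0 : lebesgue_cons set0 = 0%E.
Proof. by rewrite /lebesgue_cons /pushforward preimage_set0 measure0. Qed.

Let lebesgue_cons_ge0 A : (0 <= lebesgue_cons A)%E.
Proof.
have mf := @measurable_cons_rV n.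
exact: measure_ge0.
Qed.

Let lebesgue_cons_sigma_additive : semi_sigma_additive lebesgue_cons.
Proof.
have mf := @measurable_cons_rV n.
exact: measure_semi_sigma_additive.
Qed.

HB.instance Definition _ := isMeasure.Build _ _ _ lebesgue_cons
  lebesgue_cons0 lebesgue_cons_ge0 lebesgue_cons_sigma_additive.

Let lebesgue_cons_sigma_finite : sigma_finite setT lebesgue_cons.
Proof.
have /sigma_finiteP[G [TG ndG Goo]] := sigma_finiteT m.
have /sigma_finiteP[F [TF ndF Foo]] := sigma_finiteT (@lebesgue_measure R).
exists (fun k => [set x : 'rV[R]_n.+1 | F k (x 0 0) /\ G k (behead_rV x)]).
  apply/seteqP; split => // x _.
  have [i _ Fi] : (\bigcup_i F i) (x 0 0) by rewrite -TF.
  have [j _ Gj] : (\bigcup_i G i) (behead_rV x) by rewrite -TG.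
  exists (maxn i j) => //; split.
    by move: Fi; exact/subsetPset/ndF/leq_maxl.
  by move: Gj; exact/subsetPset/ndG/leq_maxr.
move=> k; have [mF Fk] := Foo k; have [mG Gk] := Goo k; split.
  apply: measurableI.
    rewrite -[X in measurable X]setTI.
    exact: (@measurable_head_rV n measurableT _ mF).
  rewrite -[X in measurable X]setTI.
  exact: (@measurable_behead_rV n measurableT _ mG).
rewrite /lebesgue_cons /pushforward.
rewrite [X in (_ X < _)%E](_ : _ = F k `*` G k); last first.
  by apply/seteqP; split => p /=; rewrite head_consK behead_consK.
by rewrite product_measure1E// lte_mul_pinfty// ge0_fin_numE.
Qed.

HB.instance Definition _ := Measure_isSigmaFinite.Build _ _ _ lebesgue_cons
  lebesgue_cons_sigma_finite.

End cons.

(* Iterated product of the Lebesgue measure of the line; see the value on      *)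
(* boxes below.                                                                *)
Fixpoint lebesgue_rV n : {sigma_finite_measure set 'rV[R]_n -> \bar R} :=
  match n with
  | 0 => dirac (0 : 'rV[R]_0)
  | k.+1 => lebesgue_cons (lebesgue_rV k)
  end.

Lemma lebesgue_rV_box n (a b : 'rV[R]_n) :
  (forall j, a 0 j <= b 0 j) ->
  lebesgue_rV n [set x | forall j, a 0 j <= x 0 j <= b 0 j] =
  (\prod_j (b 0 j - a 0 j))%:E.
Proof.
elim: n a b => [|n IH] a b ab.
  by rewrite big_ord0 /= diracE mem_set// => -[].
rewrite /= /lebesgue_cons /pushforward.
pose B := [set x : 'rV[R]_n | forall j, behead_rV a 0 j <= x 0 j <= behead_rV b 0 j].
have -> : @cons_rV n @^-1` [set x | forall j, a 0 j <= x 0 j <= b 0 j] =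
    [set` `[a 0 0, b 0 0]] `*` B.
  apply/seteqP; split => p /=.
    move=> h; split; first by have := h 0; rewrite head_consK in_itv.
    by move=> j; have := h (lift 0 j); rewrite !mxE liftK.
  move=> [+ h] j; rewrite /= in_itv/= mxE => h0.
  by case: unliftP => [k|] -> //=; have := h k; rewrite !mxE.
have mB : measurable B.
  rewrite (_ : B = \bigcap_(j in [set: 'I_n])
     ((fun x : 'rV[R]_n => x 0 j) @^-1` `[behead_rV a 0 j, behead_rV b 0 j])).
    apply: fin_bigcap_measurable => // j _; apply: closed_measurable_rV.
    apply: closed_comp; last exact: interval_closed.
    by move=> x _; exact: coord_continuous.
  apply/seteqP; split => [x Bx j _|x Bx j]; first by rewrite /= in_itv/=.
  by have := Bx j I; rewrite /= in_itv.
rewrite product_measure1E//= IH => [|j]; last by rewrite !mxE.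
rewrite lebesgue_measure_itv/= lte_fin big_ord_recl.
under eq_bigr do rewrite !mxE.
case: ltP => [_|/(conj (ab 0))/andP/le_anti ->]; first by rewrite EFinM EFinB.
by rewrite subrr !mul0r mul0e.
Qed.

End lebesgue_rV.

Section polyhedral_domains.
Context {R : realType} {d : nat}.
Local Notation V := 'rV[R]_d.

Definition dotp (x y : V) : R := \sum_i x 0 i * y 0 i.

(* The norm [`|x|] of the library on row vectors is the maximum norm. *)
Definition enorm (x : V) : R := Num.sqrt (dotp x x).

Definition boundary (A : set V) : set V := closure A `\` A^°.

Lemma measurable_boundary A : measurable (boundary A).
Proof.
apply: measurableD; last by apply: open_measurable_rV; exact: open_interior.
by apply: closed_measurable_rV; apply: closed_closure.
Qed.

Lemma dotp_continuous (y : V) : continuous (dotp ^~ y).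
Proof.
apply: continuous_big => [|i _ x]; first exact: add_continuous.
apply: (@continuousM _ _ (fun z : V => z 0 i) (fun=> y 0 i)).
  exact: coord_continuous.
exact: cst_continuous.
Qed.

Definition hyperplane (p : V * R) : set V := [set x | dotp x p.1 = p.2].

(* For [p.1] a unit vector: the unit slab on one side of the hyperplane and    *)
(* the orthogonal projection onto it.                                          *)
Definition hyperplane_slab (p : V * R) : set V :=
  [set x | 0 <= dotp x p.1 - p.2 <= 1].

Definition hyperplane_proj (p : V * R) (x : V) : V :=
  x - (dotp x p.1 - p.2) *: p.1.

Let dist_continuous (p : V * R) : continuous (fun x : V => dotp x p.1 - p.2).
Proof.
move=> x; apply: (@continuousB _ _ _ (dotp ^~ p.1) (fun=> p.2)).
  exact: dotp_continuous.
exact: cst_continuous.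
Qed.

Lemma measurable_hyperplane_slab p : measurable (hyperplane_slab p).
Proof.
apply: closed_measurable_rV.
rewrite (_ : hyperplane_slab p =
    (fun x : V => dotp x p.1 - p.2) @^-1` [set` `[0, 1]]); last first.
  by apply/seteqP; split => x /=; rewrite in_itv.
apply: closed_comp; last exact: interval_closed.
by move=> x _; exact: dist_continuous.
Qed.

Lemma measurable_hyperplane_proj p : measurable_fun setT (hyperplane_proj p).
Proof.
apply: continuous_measurable_rV => x.
apply: (@continuousB _ _ _ id); first by [].
by apply: continuousZr_tmp; exact: dist_continuous.
Qed.

(* The (d-1)-dimensional area of the part of [A] in the hyperplane [p]: the    *)
(* volume of the right prism of height 1 over it.                              *)
Definition hyperplane_area (p : V * R) : set V -> \bar R :=
  pushforward (mrestr (lebesgue_rV d) (measurable_hyperplane_slab p))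
    (hyperplane_proj p).

Let hyperplane_area0 p : hyperplane_area p set0 = 0%E.
Proof. by rewrite /hyperplane_area /pushforward preimage_set0 measure0. Qed.

Let hyperplane_area_ge0 p A : (0 <= hyperplane_area p A)%E.
Proof. have mf := measurable_hyperplane_proj p; exact: measure_ge0. Qed.

Let hyperplane_area_sigma_additive p : semi_sigma_additive (hyperplane_area p).
Proof.
have mf := measurable_hyperplane_proj p; exact: measure_semi_sigma_additive.
Qed.

HB.instance Definition _ p := isMeasure.Build _ _ _ (hyperplane_area p)
  (hyperplane_area0 p) (@hyperplane_area_ge0 p)
  (@hyperplane_area_sigma_additive p).

(* Near each boundary point, [A] is the strict epigraph, in some unit          *)
(* direction [e], of a Lipschitz function of the component orthogonal to [e].  *)
Definition lipschitz_boundary (A : set V) : Prop :=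
  forall x, boundary A x -> exists (e : V) (h : V -> R),
    [/\ dotp e e = 1, lipschitz h, (forall y t, h (y + t *: e) = h y) &
        \forall y \near x, A y <-> h y < dotp y e].

(* A bounded domain whose boundary lies in finitely many hyperplanes           *)
(* {x | x . nu = c}, listed without repetition as pairs (nu, c), |nu| = 1.     *)
Record polyhedral_domain := PolyhedralDomain {
  domain :> set V ;
  planes : seq (V * R) ;
  domain_neq0 : domain !=set0 ;
  domain_open : open domain ;
  domain_connected : connected domain ;
  domain_bounded : bounded_set domain ;
  planes_unit : forall p, p \in planes -> dotp p.1 p.1 = 1 ;
  planes_distinct : forall i j, (i < j < size planes)%N ->
    hyperplane (nth (0, 0) planes i) <> hyperplane (nth (0, 0) planes j) ;
  boundary_planes : boundary domain `<=`
    [set x | exists2 p, p \in planes & hyperplane p x]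
}.

(* Surface measure on the boundary; distinct hyperplanes overlap in a set of   *)
(* zero area, so that nothing is counted twice.                                *)
Definition surface (Om : polyhedral_domain) : {measure set V -> \bar R} :=
  mrestr (msum (fun k => hyperplane_area (nth (0, 0) (planes Om) k))
            (size (planes Om)))
    (measurable_boundary Om).

(* Near a point of a facet off the other facets, the domain is the half-space  *)
(* opposite to the outward normal.                                             *)
Definition is_outward_normal (A : set V) (x nu : V) : Prop :=
  dotp nu nu = 1 /\ \forall y \near x, A y <-> dotp (y - x) nu < 0.

(* 0 at the boundary points that have no normal (they form a null set). *)
Definition outward_normal (A : set V) (x : V) : V :=
  xget 0 [set nu | is_outward_normal A x nu].

End polyhedral_domains.
Arguments polyhedral_domain : clear implicits.

Section function_spaces.
Context {R : realType} {d : nat}.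
Local Notation V := 'rV[R]_d.
Local Notation leb := (lebesgue_rV d).
Implicit Types (A K : set V) (F phi : V -> R).

Definition basis_vec (i : 'I_d) : V := delta_mx 0 i.

Definition grad phi (x : V) : V := \row_i 'D_(basis_vec i) phi x.

Definition divergence (b : V -> V) (x : V) : R :=
  \sum_i 'D_(basis_vec i) (fun y => b y 0 i) x.

(* C^1 in the interior, with first derivatives extending continuously to the   *)
(* closure.                                                                    *)
Definition C1_closure A F : Prop :=
  {within closure A, continuous F} /\
  forall i, exists2 G : V -> R, {within closure A, continuous G} &
    forall x, A x -> is_derive x (basis_vec i) F (G x).

Fixpoint Ck (k : nat) phi : Prop :=
  continuous phi /\
  if k is l.+1 then
    forall i, (forall x, derivable phi x (basis_vec i)) /\
              Ck l ('D_(basis_vec i) phi)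
  else True.

Definition smooth phi : Prop := forall k, Ck k phi.

(* C^oo functions on the whole space with compact support contained in [A]. *)
Definition test_function A phi : Prop :=
  smooth phi /\
  exists K, [/\ compact K, K `<=` A & forall x, ~ K x -> phi x = 0].

(* Functions on [A] are represented by functions on the whole space, whose     *)
(* values off [A] are discarded ([F \_ A] extends the restriction by 0).       *)
Definition Lp A (p : \bar R) F : Prop := (F \_ A) \in Lfun leb p.

Definition L2norm A F : R := fine ('N[leb]_(2%:E)[EFin \o (F \_ A)])%E.

Definition L2norm_vec A (t : V -> V) : R :=
  Num.sqrt (\sum_i L2norm A (fun x => t x 0 i) ^+ 2).

(* H(div; A) as a set of pairs: a vector field and its weak divergence, which  *)
(* the field determines up to a null set.                                      *)
Definition field_div : Type := ((V -> V) * (V -> R))%type.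

Definition Hdiv A : set field_div := [set t : field_div |
  [/\ forall i, Lp A 2%:E (fun x => t.1 x 0 i),
      Lp A 2%:E t.2 &
      forall phi, test_function A phi ->
        \int[leb]_(x in A) dotp (t.1 x) (grad phi x) =
        - \int[leb]_(x in A) (t.2 x * phi x)]].

End function_spaces.
Arguments field_div : clear implicits.
Arguments Lp {R d} A p%_E F.

Section transport.
Context {R : realType} {d : nat}.
Local Notation V := 'rV[R]_d.
Variables (Om : polyhedral_domain R d) (beta : V -> V).

Definition normal_flux (x : V) : R := dotp (beta x) (outward_normal Om x).

Definition inflow : set V := [set x | boundary Om x /\ normal_flux x < 0].

Definition outflow : set V := [set x | boundary Om x /\ 0 < normal_flux x].

(* A piece, of length [L], of a streamline inside the domain, parametrized by  *)
(* arc length.                                                                 *)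
Definition streamline (X : R -> V) (L : R) : Prop :=
  [/\ 0 < L, {within `[0, L], continuous X} &
      forall s, 0 < s < L ->
        domain Om (X s) /\
        is_derive s (1 : R) X ((enorm (beta (X s)))^-1 *: beta (X s))].

(* The closures make up for the points without normal, which belong neither to *)
(* the inflow nor to the outflow boundary.                                     *)
Definition streamlines_cross : Prop :=
  forall x, domain Om x -> exists (X : R -> V) (L s : R),
    [/\ streamline X L, 0 < s < L, X s = x,
        closure inflow (X 0) & closure outflow (X L)].

(* Along the streamlines from the inflow boundary only the coordinate [r] of   *)
(* [Phi] varies.                                                               *)
Definition streamline_coordinates (Phi : V -> V) (r : 'I_d) : Prop :=
  [/\ forall x, domain Om x -> differentiable Phi x /\
                        {for x, continuous (jacobian Phi)},
      forall x y, domain Om x -> domain Om y -> Phi x = Phi y -> x = y,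
      forall x, domain Om x -> \det (jacobian Phi x) != 0,
      exists C : R, forall x, domain Om x -> `|\det (jacobian Phi x)| <= C &
      forall X L, streamline X L -> closure inflow (X 0) ->
        forall s t, 0 < s < L -> 0 < t < L ->
        forall j, j != r -> Phi (X s) 0 j = Phi (X t) 0 j].

Definition streamline_condition : Prop :=
  [/\ exists C : R, forall x, domain Om x -> 0 < enorm (beta x) < C,
      exists Phi r, streamline_coordinates Phi r &
      streamlines_cross].

Definition coercive_condition (gamma : V -> R) : Prop :=
  (exists2 gamma0 : R, 0 < gamma0 &
     {ae lebesgue_rV d, forall x, domain Om x ->
        gamma0 <= gamma x + 2^-1 * divergence beta x}) /\
  (exists2 delta : R, 0 < delta &
     forall x y, inflow x -> outflow y -> delta <= enorm (x - y)).

(* H_{g,-}(div; Om): the identity tau.n = (beta.n) g on the inflow boundary is *)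
(* Green's formula tested with the functions vanishing on the rest of the      *)
(* boundary.                                                                   *)
Definition Hdiv_inflow (g : V -> R) : set (field_div R d) := [set t : field_div R d |
  Hdiv Om t /\
  forall phi : V -> R, test_function setT phi ->
    {ae surface Om, forall x, boundary Om x -> ~ inflow x -> phi x = 0} ->
    \int[lebesgue_rV d]_(x in Om) (dotp (t.1 x) (grad phi x) + t.2 x * phi x) =
    \int[surface Om]_(x in inflow) (normal_flux x * g x * phi x)].

Definition LS_functional (gamma f : V -> R)
    (tv : field_div R d * (V -> R)) : R :=
  L2norm_vec Om (fun x => tv.1.1 x - tv.2 x *: beta x) ^+ 2 +
  L2norm Om (fun x => tv.1.2 x + gamma x * tv.2 x - f x) ^+ 2.

Definition energy_norm (gamma : V -> R)
    (tv : field_div R d * (V -> R)) : R :=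
  Num.sqrt (L2norm_vec Om (fun x => tv.1.1 x - tv.2 x *: beta x) ^+ 2 +
            L2norm Om (fun x => tv.1.2 x + gamma x * tv.2 x) ^+ 2).

End transport.

Definition is_minimizer {T : Type} {R : realType} (J : T -> R) (A : set T)
    (a : T) : Prop :=
  A a /\ forall b, A b -> J a <= J b.

Section finite_elements.
Context {R : realType} {d : nat}.
Local Notation V := 'rV[R]_d.

(* Polynomial functions in d variables of degree at most [k] ([msize] is the   *)
(* degree plus 1).                                                             *)
Definition is_poly (k : nat) (q : V -> R) : Prop :=
  exists2 p : mpoly.mpoly d R, (mpoly.msize p <= k.+1)%N &
    forall x, q x = mpoly.meval (fun i => x 0 i) p.

(* Convex hull of the vertices of the simplex [v] with index in [I]. *)
Definition face (v : 'I_d.+1 -> V) (I : {set 'I_d.+1}) : set V :=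
  [set x | exists t : 'I_d.+1 -> R,
     [/\ forall i, 0 <= t i, forall i, i \notin I -> t i = 0,
         \sum_i t i = 1 & x = \sum_i t i *: v i]].

Definition simplex (v : 'I_d.+1 -> V) : set V := face v [set: 'I_d.+1]%SET.

Record triangulation (Om : polyhedral_domain R d) := Triangulation {
  ncells : nat ;
  vertex : 'I_ncells -> 'I_d.+1 -> V ;
  vertex_free : forall c,
    \matrix_i (vertex c (lift ord0 i) - vertex c ord0) \in unitmx ;
  cells_cover : closure Om = \bigcup_c simplex (vertex c) ;
  cells_conforming : forall c c', c != c' ->
    exists I I' : {set 'I_d.+1},
      [/\ I \proper [set: 'I_d.+1]%SET, I' \proper [set: 'I_d.+1]%SET,
          simplex (vertex c) `&` simplex (vertex c') = face (vertex c) I &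
          simplex (vertex c) `&` simplex (vertex c') = face (vertex c') I']
}.

Definition cell Om (T : triangulation Om) (c : 'I_(ncells T)) : set V :=
  simplex (vertex c).

(* The diameter of each cell is at most [kappa] times that of some ball        *)
(* contained in the cell.                                                      *)
Definition shape_regular Om (T : triangulation Om) (kappa : R) : Prop :=
  forall c : 'I_(ncells T), exists (z : V) (rho : R),
    [/\ 0 < rho, [set x | enorm (x - z) <= rho] `<=` cell c &
        forall x y, cell c x -> cell c y -> enorm (x - y) <= kappa * (2 * rho)].

Variables (Om : polyhedral_domain R d) (T : triangulation Om) (beta : V -> V).

(* The face of the cell [ci.1] opposite to its vertex [ci.2]. *)
Definition mesh_face (ci : 'I_(ncells T) * 'I_d.+1) : set V :=
  face (vertex ci.1) [set~ ci.2]%SET.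

(* The indices of E_-; the faces are closed, hence the null set. *)
Definition inflow_faces : set ('I_(ncells T) * 'I_d.+1) := [set ci |
  mesh_face ci `<=` boundary Om /\
  (surface Om).-negligible (mesh_face ci `\` inflow Om beta)].

Definition RT (k : nat) : set (field_div R d) := [set t : field_div R d |
  Hdiv Om t /\
  forall c : 'I_(ncells T), exists (p : 'I_d -> V -> R) (q : V -> R),
    [/\ forall i, is_poly k (p i), is_poly k q &
        {ae lebesgue_rV d, forall x, cell c x ->
           t.1 x = \row_i p i x + q x *: x}]].

Definition RT_inflow (k : nat) (g : V -> R) : set (field_div R d) :=
  RT k `&` Hdiv_inflow Om beta g.

Definition Pk (k : nat) : set (V -> R) := [set v |
  Lp Om 2%:E v /\
  forall c : 'I_(ncells T), exists2 q : V -> R, is_poly k q &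
    {ae lebesgue_rV d, forall x, cell c x -> v x = q x}].

End finite_elements.
Arguments inflow_faces {R d Om} T beta _.

(* Main.v *)
Require Import Defs.
From mathcomp Require Import all_boot all_order all_algebra.
From mathcomp Require Import all_classical all_reals all_analysis.
From mathcomp Require Import measurable_realfun ess_sup_inf hoelder ring lra.

Import Order.TTheory GRing.Theory Num.Theory numFieldNormedType.Exports.

Local Open Scope classical_set_scope.
Local Open Scope ring_scope.

(** The residual of the least-squares functional is affine in the unknown, and
the admissible pairs form an affine space on which it is square integrable:
Green's formula defining the normal trace is affine in the flux.  Along the line
through the minimizer [a] and an admissible [b] the functional is a quadratic
polynomial whose linear coefficient vanishes by minimality, so that
[energy_norm (a - b) ^+ 2 = J b - J a].  On the discrete space, which consists of
admissible pairs, the minimizer of [J] thus minimizes the distance to [a]; the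
linear structure of the discrete space plays no role. *)

(** * Essential boundedness and square integrability *)

Section Lfun.
Context {d0 : measure_display} {T : measurableType d0} {R : realType}.
Variable mu : {measure set T -> \bar R}.
Implicit Types f g : T -> R.

(** The essential supremum of [|f|] is itself such a bound as soon as it is a real number. *)
Lemma Lfuny_ae_bounded f : f \in Lfun mu +oo%E ->
  exists M : R, {ae mu, forall x, `|f x| <= M}.
Proof.
rewrite inE => /andP[/[!inE]/= mf]; rewrite /finite_norm unlock.
case: ifPn => [mu0 fy|]; last first.
  (* Here the measure is zero: the whole space is null and any constant is a bound. *)
  rewrite -leNgt => mu0 _; exists 0; exists setT; split => //.
  by apply/eqP; rewrite eq_le mu0 measure_ge0.
move: fy; set s := ess_sup _ _ => sy.
have ae_s := ess_sup_ge mu (abse \o (EFin \o f)).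
exists (fine s); apply: filterS ae_s => x /=; rewrite -/s => fs.
(* That [s] is not -oo follows from its dominating [|f x|] at the point at hand. *)
rewrite -lee_fin fineK// fin_numElt sy andbT.
by apply: lt_le_trans fs; rewrite ltNyr.
Qed.

Lemma Lfun2P f :
  f \in Lfun mu 2%:E <->
  measurable_fun setT f /\ (\int[mu]_x (f x ^+ 2)%:E < +oo)%E.
Proof.
have sqrE x : (`|(EFin \o f) x| `^ 2)%E = (f x ^+ 2)%:E.
  by rewrite /= powR_mulrn// real_normK// num_real.
split=> [|[mf f2]].
  move=> f2; have /integrableP[_] := Lfun2_integrable_sqr f2.
  have mf : measurable_fun setT f by have := sub_Lfun_mfun f2; rewrite inE.
  split => //; move: b; under eq_integral do rewrite /= ger0_norm ?sqr_ge0//.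
  by [].
rewrite inE; apply/andP; split; rewrite inE//= /finite_norm unlock.
by apply: poweR_lty; under eq_integral do rewrite sqrE.
Qed.

(** With [M] an essential bound of [f], the square of the product is at most [M ^+ 2 * g ^+ 2]
    almost everywhere. *)
Lemma Lfuny_mul_Lfun2 f g :
  f \in Lfun mu +oo%E -> g \in Lfun mu 2%:E -> f \* g \in Lfun mu 2%:E.
Proof.
move=> fy /Lfun2P[mg g2]; have [M fM] := Lfuny_ae_bounded _ fy.
have mf : measurable_fun setT f by have := sub_Lfun_mfun fy; rewrite inE.
have mfg : measurable_fun setT (f \* g) by exact: measurable_funM.
apply/Lfun2P; split => //.
apply: (@le_lt_trans _ _ (\int[mu]_x ((M ^+ 2)%:E * (g x ^+ 2)%:E)%E)%E).
  apply: ae_ge0_le_integral => //.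
  - by move=> x _; rewrite lee_fin sqr_ge0.
  - by apply/measurable_EFinP; exact: measurable_funX.
  - by move=> x _; rewrite -EFinM lee_fin mulr_ge0 ?sqr_ge0.
  - apply/measurable_EFinP; apply: measurable_funM => //.
    exact: measurable_funX.
  - apply: filterS fM => x fxM _.
    rewrite -EFinM lee_fin exprMn ler_wpM2r ?sqr_ge0//.
    by rewrite -(real_normK (num_real (f x))) lerXn2r// ?nnegrE// (le_trans _ fxM).
rewrite ge0_integralZl//.
- by rewrite lte_mul_pinfty// lee_fin sqr_ge0.
- by apply/measurable_EFinP; exact: measurable_funX.
- by move=> x _; rewrite lee_fin sqr_ge0.
- by rewrite lee_fin sqr_ge0.
Qed.

End Lfun.

(** * The squared norm of L2 along a line *)

Section Lp_restrict.
Context {R : realType} {d : nat}.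
Local Notation V := 'rV[R]_d.
Local Notation leb := (lebesgue_rV d).
Implicit Types (A : set V) (F G : V -> R).

Lemma restrictM A F G : (fun x => F x * G x) \_ A = (F \_ A) \* (G \_ A).
Proof.
by apply/funext => x; rewrite /= !patchE; case: ifP => // _; rewrite mulr0.
Qed.

Lemma Lp_lincomb A (p : \bar R) F G s : (1 <= p)%E ->
  Lp A p F -> Lp A p G -> Lp A p (fun x => F x + s * G x).
Proof.
move=> p1 LF LG; rewrite /Lp.
have -> : (fun x => F x + s * G x) \_ A = F \_ A + s *: (G \_ A).
  apply/funext => x; rewrite !fctE/= patchE.
  rewrite [(F \_ A) x]patchE [(G \_ A) x]patchE.
  by case: ifP => // _; rewrite scaler0 addr0.
have [_ submod] := Lfun_submod_closed leb p1.
by rewrite addrC; apply: submod.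
Qed.

Lemma LpyM A F G : Lp A +oo F -> Lp A 2%:E G -> Lp A 2%:E (fun x => F x * G x).
Proof. by move=> LF LG; rewrite /Lp restrictM; exact: Lfuny_mul_Lfun2. Qed.

Lemma Lp2M_integrable A F G : measurable A -> Lp A 2%:E F -> Lp A 2%:E G ->
  leb.-integrable A (EFin \o (fun x => F x * G x)).
Proof.
move=> mA LF LG; apply/(integrable_mkcond _ mA); rewrite restrict_EFin.
by apply/Lfun1_integrable; rewrite restrictM; exact: Lfun2_mul_Lfun1.
Qed.

(** Square integrability makes the extended norm finite, so that [fine] commutes with squaring. *)
Lemma L2norm_sqr A F : Lp A 2%:E F ->
  L2norm A F ^+ 2 = \int[leb]_(x in A) (F x * F x).
Proof.
move=> LF; have [mF F2] := (Lfun2P _ _).1 LF.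
rewrite Rintegral_mkcond /Rintegral /L2norm.
set N := ('N[leb]_(2%:E)[EFin \o (F \_ A)])%E.
have N_fin : N \is a fin_num.
  rewrite ge0_fin_numE ?Lnorm_ge0//.
  by have := sub_Lfun_finLfun LF; rewrite inE.
have -> : (\int[leb]_x ((fun y => F y * F y) \_ A x)%:E = N `^ 2)%E.
  rewrite /N powR_Lnorm//; apply: eq_integral => x _ /=.
  rewrite powR_mulrn// real_normK ?num_real// !patchE.
  by case: ifP => // _; rewrite expr0n.
rewrite -(fineK N_fin) poweR_EFin/= powR_mulrn//; exact/fine_ge0/Lnorm_ge0.
Qed.

(** Expansion of the square, all products being integrable by Hölder. The coefficient [c] is twice
    the inner product; it stays existential because later it is only shown to vanish. *)
Lemma L2norm_sqr_line A F G : measurable A -> Lp A 2%:E F -> Lp A 2%:E G ->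
  exists c : R, forall s, L2norm A (fun x => F x + s * G x) ^+ 2 =
    L2norm A F ^+ 2 + s * c + s ^+ 2 * L2norm A G ^+ 2.
Proof.
move=> mA LF LG; exists (2 * \int[leb]_(x in A) (F x * G x)) => s.
have iFF := Lp2M_integrable _ _ _ mA LF LF.
have iFG := Lp2M_integrable _ _ _ mA LF LG.
have iGG := Lp2M_integrable _ _ _ mA LG LG.
rewrite !L2norm_sqr//; last by apply: Lp_lincomb; rewrite ?lee1n.
have iZ a H : leb.-integrable A (EFin \o H) ->
    leb.-integrable A (EFin \o (fun x => a * H x)).
  by move=> iH; have := integrableZl mA a iH.
transitivity (\int[leb]_(x in A)
    (F x * F x + (2 * s) * (F x * G x) + s ^+ 2 * (G x * G x))).
  by apply: eq_Rintegral => x _; ring.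
have iFG2 := iZ (2 * s) _ iFG; have iGG2 := iZ (s ^+ 2) _ iGG.
rewrite RintegralD//; last exact: (integrableD mA iFF iFG2).
by rewrite RintegralD// !RintegralZl//; ring.
Qed.

(** * Bounded sets: finite volume, and functions continuous up to the boundary *)

Lemma closed_norm_le (M : R) : closed [set x : V | `|x| <= M].
Proof.
rewrite (_ : mkset _ = Num.norm @^-1` [set r : R | r <= M])//.
apply: closed_comp => [x _|]; first exact: norm_continuous.
exact: closed_le.
Qed.

Lemma bounded_closure A : bounded_set A -> bounded_set (closure A).
Proof.
move=> [M [Mreal AM]]; exists M; split => // N MN x.
have /closureS := AM _ MN; move=> /[apply].
by rewrite -(iffLR (closure_id _) (closed_norm_le N)).
Qed.

(** The norm on row vectors is the maximum norm, so its closed balls are cubes, whose volume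
    [lebesgue_rV_box] provides. *)
Lemma norm_le_box (M : R) : 0 <= M -> [set x : V | `|x| <= M] =
  [set x | forall j, (const_mx (- M) : V) 0 j <= x 0 j <= (const_mx M : V) 0 j].
Proof.
move=> M0; apply/seteqP; split => x xM.
  move=> j; rewrite !mxE -ler_norml; apply: le_trans xM.
  rewrite [leRHS]/Num.norm/= mx_normrE.
  exact: (le_bigmax _ (fun ij => `|x ij.1 ij.2|) (0, j)).
rewrite /= /Num.norm/= mx_normrE; apply/bigmax_leP; split => // -[i j] _ /=.
by rewrite (ord1 i) ler_norml; have := xM j; rewrite !mxE.
Qed.

Lemma bounded_lebesgue_lty A : bounded_set A -> measurable A -> (leb A < +oo)%E.
Proof.
(* [bounded_set] gives a bound only strictly above [M], and [norm_le_box] asks for a nonnegative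
   radius. *)
move=> [M [_ AM]] mA; pose N := `|M| + 1.
have N0 : 0 <= N by rewrite addr_ge0.
have AN : A `<=` [set x : V | `|x| <= N].
  by apply: AM; rewrite /N ltr_pwDr// ler_norm.
apply: (le_lt_trans (le_measure _ _ _ AN)); rewrite ?inE//.
  by apply: closed_measurable_rV; exact: closed_norm_le.
rewrite norm_le_box//; have box := @lebesgue_rV_box R d (const_mx (- N)) (const_mx N).
by rewrite [X in (X < _)%E]box ?ltry// => j; rewrite !mxE; lra.
Qed.

(** Multiplied by a bounded function, this places bounded functions on a bounded set in L2. *)
Lemma Lp2_cst1 A : bounded_set A -> measurable A -> Lp A 2%:E (fun=> 1).
Proof.
move=> bA mA; apply/Lfun2P; split.
  by apply/(measurable_restrictT _ mA); exact: measurable_cst.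
rewrite [X in (X < _)%E](_ : _ = leb A); first exact: bounded_lebesgue_lty.
rewrite -[in RHS](setIT A) -integral_indic//; apply: eq_integral => x _.
by rewrite patchE indicE; case: ifP => // _; rewrite ?expr1n ?expr0n.
Qed.

Lemma open_continuous_measurable_rV A F : open A -> {in A, continuous F} ->
  measurable_fun A F.
Proof.
move=> oA cF; apply: (measurability _ (RGenOpens.measurableE R)).
move=> _ [_ [a [b ->]] <-]; apply: open_measurable_rV.
rewrite openE => x [Ax Fx]; apply: filterI; first exact: open_nbhs_nbhs.
by apply: (cF x (mem_set Ax)); apply: open_nbhs_nbhs; split => //; exact: interval_open.
Qed.

(** The closure of a bounded set is compact here, so [F] is bounded on it. This covers both the
    components of [beta] and the test functions. *)
Lemma Lpy_continuous_closure A F : open A -> bounded_set A ->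
  {within closure A, continuous F} -> Lp A +oo F.
Proof.
move=> oA bA cF.
have mA : measurable A by exact: open_measurable_rV.
have cFA : {in A, continuous F}.
  rewrite -continuous_open_subspace//.
  exact: continuous_subspaceW (@subset_closure _ A) cF.
have /compact_bounded[M [_ FM]] : compact (F @` closure A).
  apply: continuous_compact => //; apply: bounded_closed_compact.
    exact: bounded_closure.
  exact: closed_closure.
have {}FM x : A x -> `|F x| <= `|M| + 1.
  move=> Ax; apply: (FM (`|M| + 1)); first by rewrite ltr_pwDr// ler_norm.
  by exists x => //; exact: subset_closure.
rewrite /Lp inE; apply/andP; split; rewrite inE/=.
  by apply/(measurable_restrictT _ mA); exact: open_continuous_measurable_rV oA cFA.
rewrite /finite_norm unlock; case: ifPn => // _.
apply: (@le_lt_trans _ _ (`|M| + 1)%:E); last exact: ltry.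
apply/ess_supP/nearW => x /=; rewrite lee_fin patchE.
by case: ifPn => [/set_mem/FM//|_]; rewrite normr0 addr_ge0.
Qed.

End Lp_restrict.

(** A quadratic polynomial that vanishes at 0 and is nowhere negative has a minimum there, hence
    zero slope. *)
Lemma linear_coef_eq0 (R : realFieldType) (c e : R) : 0 <= e ->
  (forall s, 0 <= s * c + s ^+ 2 * e) -> c = 0.
Proof.
move=> e0 cs; apply/eqP; rewrite -sqrf_eq0 eq_le sqr_ge0 andbT -oppr_ge0.
have e1 : 0 < 1 + e by rewrite ltr_wpDr.
(* Near the vertex [- c / (2 * e)] of the parabola in spirit, but with a denominator that stays
   positive when [e] is 0. *)
have := cs (- c / (1 + e)).
rewrite (_ : _ + _ = - c ^+ 2 / (1 + e) ^+ 2); last by field; rewrite gt_eqF.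
by rewrite pmulr_lge0// invr_gt0 exprn_gt0.
Qed.

(** * Lines in the space of admissible fluxes *)

Section affine_line.
Context {R : realType} {d : nat}.
Local Notation V := 'rV[R]_d.
Local Notation leb := (lebesgue_rV d).

(** The direction is [t - t'], so [s = 0] gives [t] and [s = -1] gives [t']. The weak divergence
    moves along with the field. *)
Definition field_div_line (t t' : field_div R d) (s : R) : field_div R d :=
  (fun x => t.1 x + s *: (t.1 x - t'.1 x), fun x => t.2 x + s * (t.2 x - t'.2 x)).

Lemma Lp_affine (A : set V) (p : \bar R) (F G : V -> R) s : (1 <= p)%E ->
  Lp A p F -> Lp A p G -> Lp A p (fun x => F x + s * (F x - G x)).
Proof.
move=> p1 LF LG.
rewrite (_ : (fun _ => _) = fun x => (F x + s * F x) + (- s) * G x).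
  by do 2!apply: Lp_lincomb => //.
by apply/funext => x; ring.
Qed.

Lemma Rintegral_affine (A : set V) (f g : V -> R) (s : R) : measurable A ->
  leb.-integrable A (EFin \o f) -> leb.-integrable A (EFin \o g) ->
  \int[leb]_(x in A) (f x + s * (f x - g x)) =
  \int[leb]_(x in A) f x + s * (\int[leb]_(x in A) f x - \int[leb]_(x in A) g x).
Proof.
move=> mA If Ig; have Ifg := integrableB mA If Ig.
rewrite RintegralD// ?RintegralZl// ?RintegralB//.
by have := integrableZl mA s Ifg.
Qed.

Lemma test_function_Lpy (A : set V) (phi : V -> R) : open A -> bounded_set A ->
  test_function setT phi ->
  Lp A +oo phi /\ forall i, Lp A +oo (fun x => grad phi x 0 i).
Proof.
move=> oA bA [/(_ 1%N)[cphi dphi] _]; split=> [|i].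
  by apply: Lpy_continuous_closure => //; exact: continuous_subspaceT.
apply: Lpy_continuous_closure => //; apply: continuous_subspaceT.
rewrite (_ : (fun _ => _) = 'D_(basis_vec i) phi); first by have [_ []] := dphi i.
by apply/funext => x; rewrite mxE.
Qed.

Lemma test_functionS (A B : set V) (phi : V -> R) : A `<=` B ->
  test_function A phi -> test_function B phi.
Proof.
by move=> AB [smooth_phi [K [cK KA K0]]]; split => //; exists K; split => // x /KA/AB.
Qed.

Variable Om : polyhedral_domain R d.

Let oOm : open Om := @domain_open _ _ Om.
Let bOm : bounded_set Om := @domain_bounded _ _ Om.
Let mOm : measurable (Om : set V) := open_measurable_rV oOm.

Lemma integrable_Lpy_Lp2 (F G : V -> R) : Lp Om +oo F -> Lp Om 2%:E G ->
  leb.-integrable Om (EFin \o (fun x => G x * F x)).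
Proof.
move=> LF LG; apply: Lp2M_integrable => //.
rewrite (_ : F = fun x => F x * 1); first by apply: LpyM LF (Lp2_cst1 _ bOm mOm).
by apply/funext => x; rewrite mulr1.
Qed.

Section weak_form.
Variables (t : field_div R d) (phi : V -> R).
Hypotheses (Ht : Hdiv Om t) (phiP : test_function setT phi).

(** Taking [phi] on the whole space serves both the weak divergence, through [test_functionS], and
    Green's formula at the inflow boundary. *)
Lemma integrable_dotp_grad :
  leb.-integrable Om (EFin \o (fun x => dotp (t.1 x) (grad phi x))).
Proof.
have [Lt _ _] := Ht; have [_ Lgrad] := test_function_Lpy _ _ oOm bOm phiP.
rewrite (_ : EFin \o _ = fun x => \sum_i (t.1 x 0 i * grad phi x 0 i)%:E)%E.
  by apply: integrable_sum => // i _; exact: integrable_Lpy_Lp2.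
by apply/funext => x; rewrite /= sumEFin.
Qed.

Lemma integrable_div_test :
  leb.-integrable Om (EFin \o (fun x => t.2 x * phi x)).
Proof.
have [_ Lt _] := Ht; have [Lphi _] := test_function_Lpy _ _ oOm bOm phiP.
exact: integrable_Lpy_Lp2.
Qed.

End weak_form.

Lemma dotpDZ (x y z : V) (s : R) :
  dotp (x + s *: (x - y)) z = dotp x z + s * (dotp x z - dotp y z).
Proof.
rewrite /dotp -sumrB mulr_sumr -big_split/=; apply: eq_bigr => i _.
by rewrite !mxE; ring.
Qed.

(** Both sides of the weak divergence identity are affine in the pair, once the integrals are known
    to split. *)
Lemma Hdiv_line (t t' : field_div R d) (s : R) :
  Hdiv Om t -> Hdiv Om t' -> Hdiv Om (field_div_line t t' s).
Proof.
move=> Ht Ht'; have [Lt Ldt divt] := Ht; have [Lt' Ldt' divt'] := Ht'.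
split => [i||phi phiOm] /=.
- rewrite (_ : (fun _ => _) =
      fun x => t.1 x 0 i + s * (t.1 x 0 i - t'.1 x 0 i)).
    by apply: Lp_affine; rewrite ?lee1n.
  by apply/funext => x; rewrite !mxE.
- by apply: Lp_affine; rewrite ?lee1n.
have phiP : test_function setT phi by exact: test_functionS _ _ _ _ phiOm.
under eq_Rintegral do rewrite dotpDZ.
rewrite Rintegral_affine//; [|exact: integrable_dotp_grad|exact: integrable_dotp_grad].
rewrite divt// divt'//.
have -> : \int[leb]_(x in Om) ((t.2 x + s * (t.2 x - t'.2 x)) * phi x) =
    \int[leb]_(x in Om) (t.2 x * phi x + s * (t.2 x * phi x - t'.2 x * phi x)).
  by apply: eq_Rintegral => x _; ring.
rewrite Rintegral_affine//; [ring|exact: integrable_div_test|exact: integrable_div_test].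
Qed.

Variable beta : V -> V.

(** The surface integral depends on [g] and [phi] alone, so the Green integrals of [t] and [t']
    coincide and their difference drops out along the line. *)
Lemma Hdiv_inflow_line (g : V -> R) (t t' : field_div R d) (s : R) :
  Hdiv_inflow Om beta g t -> Hdiv_inflow Om beta g t' ->
  Hdiv_inflow Om beta g (field_div_line t t' s).
Proof.
move=> [Ht flux_t] [Ht' flux_t']; split; first exact: Hdiv_line.
move=> phi phiP phi0 /=.
have green u : Hdiv Om u -> leb.-integrable Om
    (EFin \o (fun x => dotp (u.1 x) (grad phi x) + u.2 x * phi x)).
  move=> Hu; have := integrableD mOm (integrable_dotp_grad _ _ Hu phiP)
    (integrable_div_test _ _ Hu phiP).
  exact.
(* Trading the surface integral for the Green integral of [t] leaves only volume integrals to be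
   split. *)
rewrite -(flux_t _ phiP phi0).
transitivity (\int[leb]_(x in Om) ((dotp (t.1 x) (grad phi x) + t.2 x * phi x) +
   s * ((dotp (t.1 x) (grad phi x) + t.2 x * phi x) -
        (dotp (t'.1 x) (grad phi x) + t'.2 x * phi x)))).
  by apply: eq_Rintegral => x _; rewrite dotpDZ; ring.
rewrite Rintegral_affine//; [|exact: green|exact: green].
by rewrite (flux_t _ phiP phi0) (flux_t' _ phiP phi0) subrr mulr0 addr0.
Qed.

End affine_line.

(** * The least-squares functional along a line *)

Section least_squares.
Context {R : realType} {d : nat}.
Local Notation V := 'rV[R]_d.
Variables (Om : polyhedral_domain R d) (beta : V -> V) (gamma f : V -> R).
Hypothesis beta_Lpy : forall i, Lp Om +oo (fun x => beta x 0 i).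
Hypothesis gamma_Lpy : Lp Om +oo gamma.
Hypothesis f_L2 : Lp Om 2%:E f.

Let mOm : measurable (Om : set V) := open_measurable_rV (@domain_open _ _ Om).

Lemma L2norm_vec_sqr (A : set V) (t : V -> V) :
  L2norm_vec A t ^+ 2 = \sum_i L2norm A (fun x => t x 0 i) ^+ 2.
Proof. by rewrite sqr_sqrtr// sumr_ge0// => i _; exact: sqr_ge0. Qed.

Lemma energy_norm_sqr (tv : field_div R d * (V -> R)) :
  energy_norm Om beta gamma tv ^+ 2 =
  L2norm_vec Om (fun x => tv.1.1 x - tv.2 x *: beta x) ^+ 2 +
  L2norm Om (fun x => tv.1.2 x + gamma x * tv.2 x) ^+ 2.
Proof. by rewrite sqr_sqrtr// addr_ge0// sqr_ge0. Qed.

Lemma Lp2_flux_residual (t : V -> V) (v : V -> R) i :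
  Lp Om 2%:E (fun x => t x 0 i) -> Lp Om 2%:E v ->
  Lp Om 2%:E (fun x => (t x - v x *: beta x) 0 i).
Proof.
move=> Lt Lv.
rewrite (_ : (fun _ => _) = fun x => t x 0 i + (-1) * (beta x 0 i * v x)).
  by apply: Lp_lincomb; rewrite ?lee1n//; exact: LpyM.
by apply/funext => x; rewrite !mxE; ring.
Qed.

(** Without [f], this applies to the pair itself, [f] being subtracted afterwards, and to the
    direction of the line, where [f] cancels. *)
Lemma Lp2_div_residual (t v : V -> R) : Lp Om 2%:E t -> Lp Om 2%:E v ->
  Lp Om 2%:E (fun x => t x + gamma x * v x).
Proof.
move=> Lt Lv.
rewrite (_ : (fun _ => _) = fun x => t x + 1 * (gamma x * v x)).
  by apply: Lp_lincomb; rewrite ?lee1n//; exact: LpyM.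
by apply/funext => x; rewrite mul1r.
Qed.

(** [L2norm_sqr_line] applies to every component of the residual. The factor of [s] in the residual
    is the homogeneous residual of the direction, whence the energy norm as leading coefficient. *)
Lemma LS_functional_line (t t' : field_div R d) (v v' : V -> R) :
  Hdiv Om t -> Hdiv Om t' -> Lp Om 2%:E v -> Lp Om 2%:E v' ->
  exists c : R, forall s,
    LS_functional Om beta gamma f
      (field_div_line t t' s, fun x => v x + s * (v x - v' x)) =
    LS_functional Om beta gamma f (t, v) + s * c +
    s ^+ 2 * energy_norm Om beta gamma (t - t', v - v') ^+ 2.
Proof.
move=> [Lt Ldt _] [Lt' Ldt' _] Lv Lv'.
have Lw i : Lp Om 2%:E (fun x => (t.1 - t'.1) x 0 i).
  rewrite (_ : (fun _ => _) = fun x => t.1 x 0 i + (-1) * t'.1 x 0 i).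
    by apply: Lp_lincomb; rewrite ?lee1n.
  by apply/funext => x; rewrite !mxE mulN1r.
have LB (F G : V -> R) : Lp Om 2%:E F -> Lp Om 2%:E G -> Lp Om 2%:E (F - G).
  move=> LF LG; rewrite (_ : F - G = fun x => F x + (-1) * G x).
    by apply: Lp_lincomb; rewrite ?lee1n.
  by apply/funext => x; rewrite mulN1r.
have Lz := LB _ _ Lv Lv'.
have /choice[c1 cP1] i := L2norm_sqr_line _ _ _ mOm
  (Lp2_flux_residual _ _ _ (Lt i) Lv) (Lp2_flux_residual _ _ _ (Lw i) Lz).
have [c2 cP2] := L2norm_sqr_line _ _ _ mOm
  (LB _ _ (Lp2_div_residual _ _ Ldt Lv) f_L2)
  (Lp2_div_residual _ _ (LB _ _ Ldt Ldt') Lz).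
exists (\sum_i c1 i + c2) => s.
rewrite energy_norm_sqr /LS_functional !L2norm_vec_sqr /=.
have -> : \sum_i L2norm Om (fun x => (t.1 x + s *: (t.1 x - t'.1 x) -
      (v x + s * (v x - v' x)) *: beta x) 0 i) ^+ 2 =
    \sum_i (L2norm Om (fun x => (t.1 x - v x *: beta x) 0 i) ^+ 2 + s * c1 i +
    s ^+ 2 * L2norm Om (fun x => ((t.1 - t'.1) x - (v - v') x *: beta x) 0 i) ^+ 2).
  apply: eq_bigr => i _; rewrite -cP1; congr (L2norm _ _ ^+ 2).
  by apply/funext => x; rewrite !fctE !mxE; ring.
have -> : L2norm Om (fun x => t.2 x + s * (t.2 x - t'.2 x) +
      gamma x * (v x + s * (v x - v' x)) - f x) ^+ 2 =
    L2norm Om (fun x => t.2 x + gamma x * v x - f x) ^+ 2 + s * c2 +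
    s ^+ 2 * L2norm Om (fun x => (t.2 - t'.2) x + gamma x * (v - v') x) ^+ 2.
  rewrite -cP2; congr (L2norm _ _ ^+ 2).
  by apply/funext => x; rewrite !fctE; ring.
rewrite !big_split/= -!mulr_sumr; ring.
Qed.

Variable g : V -> R.

(** A Pythagorean identity: the admissible set contains the whole line, so [s] takes both signs and
    minimality forces the linear coefficient to vanish. *)
Lemma energy_norm_minimizer (t t' : field_div R d) (v v' : V -> R) :
  is_minimizer (LS_functional Om beta gamma f)
    (Hdiv_inflow Om beta g `*` Lp Om 2%:E) (t, v) ->
  Hdiv_inflow Om beta g t' -> Lp Om 2%:E v' ->
  energy_norm Om beta gamma (t - t', v - v') ^+ 2 =
  LS_functional Om beta gamma f (t', v') - LS_functional Om beta gamma f (t, v).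
Proof.
move=> [[/= Xt Lv] tv_min] Xt' Lv'.
have [c cP] := LS_functional_line _ _ _ _ Xt.1 Xt'.1 Lv Lv'.
have c0 : c = 0.
  apply: (@linear_coef_eq0 R c (energy_norm Om beta gamma (t - t', v - v') ^+ 2)).
    exact: sqr_ge0.
  move=> s; rewrite -(lerD2l (LS_functional Om beta gamma f (t, v))) addr0 addrA -cP.
  apply: tv_min; split => /=; first exact: Hdiv_inflow_line.
  by apply: Lp_affine; rewrite ?lee1n.
(* At [s = -1] the line reaches [(t', v')] and the quadratic term has coefficient 1. *)
have := cP (-1); rewrite c0 mulr0 addr0 sqrrN expr1n mul1r.
have -> : field_div_line t t' (-1) = t'.
  rewrite [RHS]surjective_pairing /field_div_line; congr pair; apply/funext => x.
    by rewrite scaleN1r subKr.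
  by rewrite mulN1r subKr.
have -> : (fun x => v x + -1 * (v x - v' x)) = v'.
  by apply/funext => x; rewrite mulN1r subKr.
by move=> ->; rewrite addrAC subrr add0r.
Qed.

End least_squares.

(** * Comparison with the discrete minimizer *)

Theorem theorem4p3 (R : realType) (d : nat) (d_gt0 : (0 < d)%N)
  (Om : polyhedral_domain R d) (Om_lipschitz : lipschitz_boundary Om)
  (beta : 'rV[R]_d -> 'rV[R]_d) (gamma : 'rV[R]_d -> R)
  (beta_C1 : forall i, C1_closure Om (fun x => beta x 0 i))
  (gamma_Linfty : Lp Om +oo gamma)
  (gamma_div_ge0 : {ae lebesgue_rV d, forall x, domain Om x ->
     0 <= gamma x + 2^-1 * divergence beta x})
  (beta_cases : streamline_condition Om beta \/ coercive_condition Om beta gamma)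
  (f : 'rV[R]_d -> R) (f_L2 : Lp Om 2%:E f)
  (g : 'rV[R]_d -> R) (g_measurable : measurable_fun (inflow Om beta) g)
  (g_finite : (\int[surface Om]_(x in inflow Om beta)
     (`|normal_flux Om beta x| * g x ^+ 2)%:E < +oo)%E)
  (T : triangulation Om) (kappa : R) (T_regular : shape_regular T kappa)
  (T_inflow : (surface Om).-negligible
     (inflow Om beta `\` \bigcup_(F in inflow_faces T beta) mesh_face F))
  (k : nat)
  (g_poly : forall F, inflow_faces T beta F ->
     exists2 q : 'rV[R]_d -> R, is_poly k q &
       {ae surface Om, forall x, mesh_face F x ->
          normal_flux Om beta x * g x = q x})
  (sigma : field_div R d) (u : 'rV[R]_d -> R)
  (sigma_u_min : is_minimizer (LS_functional Om beta gamma f)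
     (Hdiv_inflow Om beta g `*` Lp Om 2%:E) (sigma, u))
  (sigma_h : field_div R d) (u_h : 'rV[R]_d -> R)
  (sigma_u_h_min : is_minimizer (LS_functional Om beta gamma f)
     (RT_inflow T beta k g `*` Pk T k) (sigma_h, u_h)) :
  energy_norm Om beta gamma (sigma - sigma_h, u - u_h) <=
  inf [set energy_norm Om beta gamma (sigma - tv.1, u - tv.2)
      | tv in RT_inflow T beta k g `*` Pk T k].
Proof.
have beta_Lpy i : Lp Om +oo (fun x => beta x 0 i).
  apply: Lpy_continuous_closure; first exact: domain_open.
    exact: domain_bounded.
  by have [] := beta_C1 i.
have pythagoras := energy_norm_minimizer _ _ _ _
  beta_Lpy gamma_Linfty f_L2 _ _ _ _ _ sigma_u_min.
(* Conformity: membership in the discrete space includes the inflow condition and square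
   integrability, as [pythagoras] requires. *)
have [[/= [_ Xh] [Lh _]] uh_min] := sigma_u_h_min.
apply: lb_le_inf.
  (* A greatest lower bound needs a nonempty set; the discrete minimizer provides an element. *)
  by eexists; exists (sigma_h, u_h); [exact: sigma_u_h_min.1|reflexivity].
move=> _ [[t v] tvh <-] /=; have [/= [_ Xt] [Lv _]] := tvh.
(* Both sides are square roots, so their squares may be compared; by [pythagoras] these differ from
   values of the functional by the same constant. *)
rewrite -(@ler_pXn2r _ 2)// ?nnegrE ?sqrtr_ge0//.
by rewrite !pythagoras// lerD2r; exact: uh_min.
Qed.
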